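(* Let $q\in[1,\infty)$, $\alpha\in\mathbb{R}$, $s\in\{0,1,2,\dots\}$, and let $Q_0$ be a cube of $\mathbb{R}^n$. Then $$\widetilde{\mathcal{C}}_{\alpha,q,s}(Q_0)=\left\{f\in\bigcap_{p\in[1,\infty)}\widetilde{JN}_{(p,q,s)_\alpha}(Q_0):\ \lim_{p\to\infty}\|f\|_{\widetilde{JN}_{(p,q,s)_\alpha}(Q_0)}<\infty\right\}$$ and, for any $f\in\widetilde{\mathcal{C}}_{\alpha,q,s}(Q_0)$, $$\|f\|_{\widetilde{\mathcal{C}}_{\alpha,q,s}(Q_0)}=\lim_{p\to\infty}\|f\|_{\widetilde{JN}_{(p,q,s)_\alpha}(Q_0)}.$$
   Context: A cube in $\mathbb{R}^n$ has finite positive edge length and edges parallel to the coordinate axes; it need not be open or closed. Functions are real-valued. $\fint_Q f:=\frac1{|Q|}\int_Q f$. For $s\in\{0,1,2,\dots\}$, a cube $Q$ and $f$ integrable on $Q$, $P^{(s)}_Q(f)$ is the unique polynomial of degree at most $s$ such that $\int_Q[f(x)-P^{(s)}_Q(f)(x)]x^\gamma\,dx=0$ for every multi-index $\gamma$ with $|\gamma|\le s$. For $f\in L^q(Q_0)$ and $p\in[1,\infty)$, $$\|f\|_{\widetilde{JN}_{(p,q,s)_\alpha}(Q_0)}:=\sup\left\{\sum_i|Q_i|\left[|Q_i|^{-\alpha}\left\{\fint_{Q_i}\left|f-P^{(s)}_{Q_i}(|f|)\right|^q\right\}^{1/q}\right]^p\right\}^{1/p},$$ the supremum being over all collections $\{Q_i\}_i$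 of cubes contained in $Q_0$ with pairwise disjoint interiors; $\widetilde{JN}_{(p,q,s)_\alpha}(Q_0)$ is the set of $f\in L^q(Q_0)$ for which this is finite. Also $$\|f\|_{\widetilde{\mathcal{C}}_{\alpha,q,s}(Q_0)}:=\sup_{Q\subset Q_0}|Q|^{-\alpha}\left[\fint_Q\left|f-P^{(s)}_Q(|f|)\right|^q\right]^{1/q},$$ the supremum being over all cubes $Q\subset Q_0$, and $\widetilde{\mathcal{C}}_{\alpha,q,s}(Q_0)$ is the set of $f\in L^q(Q_0)$ for which this is finite. *)

(* Defs.v *)
From HB Require Import structures.
From mathcomp Require Import all_boot all_order all_algebra.
From mathcomp Require Import all_classical all_reals all_analysis.
(* Importing the notations or the names of mpoly would clash with
   mathcomp-analysis, e.g. on [measure]. *)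
From mathcomp.multinomials Require mpoly.
Import (canonicals, coercions) mpoly.

Set Implicit Arguments.
Unset Strict Implicit.
Unset Printing Implicit Defensive.
Import Order.TTheory GRing.Theory Num.Theory.
Import numFieldNormedType.Exports.

Local Open Scope classical_set_scope.
Local Open Scope ring_scope.

Section lebesgue_measure_rV.
Context {R : realType} (n : nat).
Local Notation E := 'rV[R]_n.

(* The box ]a, b] with corners I = (a, b); it may be empty. *)
Definition box (I : E * E) : set E :=
  [set x | forall i, I.1 0 i < x 0 i <= I.2 0 i].

Definition box_volume (I : E * E) : R :=
  \prod_(i < n) Num.max 0 (I.2 0 i - I.1 0 i).

Definition box_cover (A : set E) : set (set (E * E)) :=
  [set D | countable D /\ A `<=` \bigcup_(I in D) box I].

Local Open Scope ereal_scope.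

Definition lebesgue_outer (A : set E) : \bar R :=
  ereal_inf [set \esum_(I in D) (box_volume I)%:E | D in box_cover A].

Let box_volume_ge0 I : 0 <= (box_volume I)%:E.
Proof. by rewrite lee_fin prodr_ge0// => i _; rewrite le_max lexx. Qed.

Lemma lebesgue_outer_ge0 A : 0 <= lebesgue_outer A.
Proof. by apply: le_ereal_inf_tmp => _ [D _ <-]; exact: esum_ge0. Qed.

Lemma lebesgue_outer0 : lebesgue_outer set0 = 0.
Proof.
apply/eqP; rewrite eq_le lebesgue_outer_ge0 andbT.
apply: ereal_inf_lbound; exists set0; last exact: esum_set0.
by split; [exact: countable0|exact: sub0set].
Qed.

Lemma le_lebesgue_outer :
  {homo lebesgue_outer : A B / A `<=` B >-> A <= B}.
Proof.
move=> A B AB; apply: ereal_inf_le_tmp => _ [D [cD BD] <-].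
by exists D => //; split => //; exact: subset_trans BD.
Qed.

Lemma lebesgue_outer_sigma_subadditive : sigma_subadditive lebesgue_outer.
Proof.
move=> A; have [[i ioo]|] := pselect (exists i, lebesgue_outer (A i) = +oo).
  rewrite (eseries_pinfty _ _ ioo) ?leey// => k _.
  by rewrite -ltNye (lt_le_trans _ (lebesgue_outer_ge0 _)).
rewrite -forallNE => Aoo.
apply/lee_addgt0Pr => _/posnumP[e].
rewrite (le_trans _ (epsilon_trick _ _ _))//; last first.
  by move=> ?; exact: lebesgue_outer_ge0.
have /choice[D PD] : forall k, exists D, box_cover (A k) D /\
    \esum_(I in D) (box_volume I)%:E <=
    lebesgue_outer (A k) + (e%:num / (2 ^ k.+1)%:R)%:E.
  move=> k; have fA : lebesgue_outer (A k) \is a fin_num.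
    by rewrite ge0_fin_numE ?lebesgue_outer_ge0// ltey; apply/eqP/Aoo.
  have ek : (0 < e%:num / (2 ^ k.+1)%:R)%R by [].
  have [_ [D cD <-] /ltW DA] := lb_ereal_inf_adherent ek fA.
  by exists D.
apply: (@le_trans _ _ (\esum_(I in \bigcup_k D k) (box_volume I)%:E)).
  apply: ereal_inf_lbound; exists (\bigcup_k D k) => //; split.
    by apply: bigcup_countable => // k _; have [[]] := PD k.
  move=> x [k _ /(PD k).1.2[I DI Ix]].
  by exists I => //; exists k.
rewrite seqDU_bigcup_eq esum_bigcupT//.
rewrite -nneseries_esumT; last by move=> k; apply: esum_ge0 => I _.
apply: lee_nneseries => [k _ _|k _]; first by apply: esum_ge0 => I _.
apply: le_trans (PD k).2; rewrite [leLHS]esum_mkcond [leRHS]esum_mkcond.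
apply: le_esum => I _; case: ifPn => [|_]; last by case: ifPn.
by rewrite inE => -[DI _]; rewrite mem_set.
Qed.

HB.instance Definition _ := isOuterMeasure.Build R E lebesgue_outer
  lebesgue_outer0 lebesgue_outer_ge0 le_lebesgue_outer
  lebesgue_outer_sigma_subadditive.

End lebesgue_measure_rV.

(* R^n with the sigma-algebra of Lebesgue (i.e., Caratheodory) measurable
   sets; it is convertible to 'rV[R]_n. *)
Notation lebesgue_rV R n := (caratheodory_type (@lebesgue_outer R n)).

Definition caratheodory_measure {R : realType} {T : pointedType}
    (mu : {outer_measure set T -> \bar R}) :
    {measure set (caratheodory_type mu) -> \bar R} :=
  [the measure _ _ of mu : set (caratheodory_type mu) -> \bar R].

Definition leb {R : realType} (n : nat) :
    {measure set (lebesgue_rV R n) -> \bar R} :=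
  caratheodory_measure (@lebesgue_outer R n).

Section johnnirenberg_campanato.
Context {R : realType} {n : nat}.
Local Notation E := 'rV[R]_n.

(* For each coordinate, the booleans [l i] and [r i] tell independently on
   which side of its two endpoints the edge is closed ([l i = true] and
   [r i = false] respectively). *)
Definition cube (Q : set E) : Prop :=
  exists (a : E) (d : R) (l r : 'I_n -> bool), 0 < d /\
    Q = [set x : E | forall i : 'I_n,
      x 0 i \in Interval (BSide (l i) (a 0 i)) (BSide (r i) (a 0 i + d))].

Definition subcubes (Q0 : set E) : set (set E) :=
  [set Q | cube Q /\ Q `<=` Q0].

Definition vol (Q : set E) : R := fine (leb n Q).

Definition average (Q : set E) (g : E -> R) : \bar R :=
  (((vol Q)^-1)%:E * \int[leb n]_(x in Q) (g x)%:E)%E.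

Definition peval (P : mpoly.mpoly n R) (x : E) : R :=
  mpoly.meval (fun i => x 0 i) P.

Definition monomial (g : mpoly.multinom n) (x : E) : R := \prod_(i < n) x 0 i ^+ g i.

(* The total degree of a polynomial of [mpoly n R] is at most [s] iff its
   [msize] is at most [s.+1]. *)
Definition is_moment_projection (s : nat) (Q : set E) (f : E -> R)
    (P : mpoly.mpoly n R) : Prop :=
  (mpoly.msize P <= s.+1)%N /\
  forall g : mpoly.multinom n, (mpoly.mdeg g <= s)%N ->
    (\int[leb n]_(x in Q) ((f x - peval P x) * monomial g x)%:E = 0)%E.

(* The unique polynomial satisfying [is_moment_projection s Q f], which exists
   for a cube Q and f integrable on Q. *)
Definition moment_projection (s : nat) (Q : set E) (f : E -> R) :
  mpoly.mpoly n R := xget 0 [set P | is_moment_projection s Q f P].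

(* Functions on Q0 are represented by functions on R^n, of which only the
   values on Q0 matter. *)
Definition Lq (q : R) (Q0 : set E) : set (E -> R) :=
  [set f | (f \_ Q0 : lebesgue_rV R n -> R) \in Lfun (leb n) q%:E].

Definition oscillation (q alpha : R) (s : nat) (f : E -> R) (Q : set E) :
    \bar R :=
  ((vol Q `^ (- alpha))%:E *
   average Q (fun x =>
     `|f x - peval (moment_projection s Q (fun y => `|f y|)) x| `^ q)%R
     `^ q^-1)%E.

Definition cube_packings (Q0 : set E) : set (set (set E)) :=
  [set D | D `<=` subcubes Q0 /\ trivIset D (fun Q => Q°)].

Definition JN_norm (p q : R) (s : nat) (alpha : R) (Q0 : set E) (f : E -> R) :
    \bar R :=
  (ereal_sup [set (\esum_(Q in D) (vol Q)%:E * oscillation q alpha s f Q `^ p)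
             | D in cube_packings Q0] `^ p^-1)%E.

Definition JN (p q : R) (s : nat) (alpha : R) (Q0 : set E) : set (E -> R) :=
  [set f | Lq q Q0 f /\ (JN_norm p q s alpha Q0 f < +oo)%E].

Definition campanato_norm (alpha q : R) (s : nat) (Q0 : set E) (f : E -> R) :
    \bar R :=
  ereal_sup [set oscillation q alpha s f Q | Q in subcubes Q0].

Definition campanato (alpha q : R) (s : nat) (Q0 : set E) : set (E -> R) :=
  [set f | Lq q Q0 f /\ (campanato_norm alpha q s Q0 f < +oo)%E].

End johnnirenberg_campanato.

(* Main.v *)
(* Write N_p for the JN norm and N for the Campanato norm. A packing reduced to
   a single cube Q gives N_p >= |Q|^(1/p) osc(Q), whence liminf N_p >= N.
   Conversely, each term of the sum defining N_p ^ p is at most |Q_i| N ^ p and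
   the sum of the |Q_i| is at most a constant C, so N_p <= C^(1/p) N, whence
   limsup N_p <= N. Any finite C will do, so the null boundary of cubes need not
   be discussed: C = 3^n |Q0| comes from comparing each Q_i with the half-open
   cube of the same centre and half the edge, which is measurable, is contained
   in the interior of Q_i, and covers Q_i when dilated by a factor 3. *)
Require Import Defs.
From mathcomp Require Import all_boot all_order all_algebra.
From mathcomp Require Import all_classical all_reals all_analysis.
From mathcomp Require Import ring lra.
Import Order.TTheory GRing.Theory Num.Theory.
Import numFieldNormedType.Exports.
Local Open Scope classical_set_scope.
Local Open Scope ring_scope.

(** * Limits at infinity, extended powers and sums *)

Lemma cvg_powR_inv {R : realType} (c : R) : 0 < c ->
  c `^ p^-1 @[p --> +oo%R] --> (1 : R).
Proof.
move=> c0; rewrite -[1](expR0 R) -[in expR 0](mul0r (ln c)).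
under eq_fun do rewrite /powR gt_eqF//.
apply: continuous_cvg; first exact: continuous_expR.
apply: cvgMr_tmp; apply/gtr0_cvgV0; last exact: cvg_id.
exact: nbhs_pinfty_gt.
Qed.

Lemma le_poweRl {R : realType} (r : R) (x y : \bar R) :
  0 <= r -> (0 <= x)%E -> (x <= y)%E -> (x `^ r <= y `^ r)%E.
Proof.
move=> r0 x0 xy; apply: gt0_ler_poweR => //; rewrite in_itv/= leey andbT//.
exact: le_trans xy.
Qed.

(** The two hypotheses are the liminf and limsup halves of the convergence. The second is vacuous
    for [l = +oo], and [0 <= l] excludes [-oo]. *)
Lemma cvge_pinfty_lt {R : realType} (f : R -> \bar R) (l : \bar R) :
    (0 <= l)%E ->
    (forall y : R, (y%:E < l)%E -> \forall p \near +oo%R, (y%:E < f p)%E) ->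
    (forall y : R, (l < y%:E)%E -> \forall p \near +oo%R, (f p < y%:E)%E) ->
  f p @[p --> +oo%R] --> l.
Proof.
case: l => [M _ lf gf|_ lf _|//]; last first.
  by apply/cvgeyPgt => A; apply: lf; rewrite ltry.
move=> A nA.
have /nbhs_ballP[e /= e0 MA] : nbhs M (fun r => A r%:E) := nA.
have le1 : ((M - e)%:E < M%:E)%E by rewrite lte_fin; lra.
have le2 : (M%:E < (M + e)%:E)%E by rewrite lte_fin; lra.
rewrite nbhs_simpl/=; near=> p; rewrite -[_ p]/(A (f p)).
have : ((M - e)%:E < f p)%E by near: p; exact: lf.
have : (f p < (M + e)%:E)%E by near: p; exact: gf.
case: (f p) => [r| |]; rewrite ?ltNge ?leey ?leNye// -!ltNge !lte_fin => h1 h2.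
by apply: MA; rewrite /ball/= ltr_distlC; lra.
Unshelve. all: by end_near. Qed.

(** As [e] may identify indices, a section [g] of [e] is chosen: it is injective on the image and
    selects a subset of [D]. *)
Lemma le_esum_image {R : realType} {T T' : choiceType} (D : set T)
    (e : T -> T') (a : T' -> \bar R) : (forall j, 0 <= a j)%E ->
  (\esum_(j in e @` D) a j <= \esum_(i in D) a (e i))%E.
Proof.
move=> a0.
have [->|/set0P[i0 Di0]] := eqVneq D set0.
  by rewrite image_set0 !esum_set0.
have /choice[g gP] : forall j, exists i, (e @` D) j -> D i /\ e i = j.
  move=> j; have [[i Di <-]|nj] := pselect ((e @` D) j); first by exists i.
  by exists i0 => /nj.
rewrite (eq_esum (b := fun j => a (e (g j)))); last by move=> j /gP[_ ->].
rewrite -(esum_image _ g (fun i => a (e i))); last first.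
  move=> j k; rewrite !inE => /gP[_ {2}<-] /gP[_ {2}<-] ->//.
apply: ereal_sup_le => x [F [finF FD] <-] ; exists F => //.
by split=> // i /FD [j /gP[+ _] <-].
Qed.

Lemma esum_mull_le {R : realType} {T : choiceType} (D : set T) (c : R)
    (a : T -> \bar R) : 0 <= c -> (forall i, 0 <= a i)%E ->
  (\esum_(i in D) (c%:E * a i) <= c%:E * \esum_(i in D) a i)%E.
Proof.
move=> c0 a0; apply: ge_ereal_sup => _ [F FD <-].
rewrite -ge0_mule_fsumr// lee_wpmul2l ?lee_fin//.
by apply: ereal_sup_ubound; exists F.
Qed.

(** Length is additive when the interval from [a] to [b], possibly empty, is cut at [c]. *)
Lemma max0_split {R : realDomainType} (a b c : R) :
  Num.max 0 (b - a) =
  Num.max 0 (Num.min b c - a) + Num.max 0 (b - Num.max a c).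
Proof.
have [bc|cb] := leP b c.
  by rewrite [Num.max 0 (b - Num.max a c)]max_l ?addr0// subr_le0 le_max bc orbT.
have [ac|ca] := leP a c.
  by rewrite !max_r; lra.
by rewrite [Num.max 0 (c - a)]max_l ?add0r// subr_le0 ltW.
Qed.

(** * Outer measure under dilation, and measurability of boxes *)

Section lebesgue_rV_boxes.
Context {R : realType} {n : nat}.
Local Notation E := 'rV[R]_n.

Lemma box_volume_ge0 (I : E * E) : 0 <= box_volume I.
Proof. by apply: prodr_ge0 => i _; rewrite le_max lexx. Qed.

Lemma lebesgue_outer_le_esum (D : set (E * E)) (phi : E * E -> E * E)
    (A : set E) : countable D -> A `<=` \bigcup_(I in D) box (phi I) ->
  (lebesgue_outer A <= \esum_(I in D) (box_volume (phi I))%:E)%E.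
Proof.
move=> cD AD; apply: le_trans; last first.
  apply: (le_esum_image D phi (fun I => (box_volume I)%:E)) => I.
  by rewrite lee_fin box_volume_ge0.
apply: ereal_inf_lbound; exists (phi @` D) => //; split.
  exact: sub_countable (card_image_le _ _) cD.
by move=> x /AD[I DI xI]; exists (phi I) => //; exists I.
Qed.

Lemma lebesgue_outer_homothety (c : R) (b : E) (A : set E) : 0 < c ->
  (lebesgue_outer [set (c *: x + b)%R | x in A]
   <= (c ^+ n)%:E * lebesgue_outer A)%E.
Proof.
(* Dividing by [c ^+ n] isolates the outer measure of [A], so that an arbitrary cover of [A] can be
   taken and dilated box by box. *)
move=> c0; rewrite muleC -lee_pdivrMr ?exprn_gt0//.
apply: le_ereal_inf_tmp => _ [D [cD AD] <-].
rewrite lee_pdivrMr ?exprn_gt0// muleC.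
have vol0 (I : E * E) : (0 <= (box_volume I)%:E)%E by rewrite lee_fin box_volume_ge0.
apply: le_trans; last by apply: esum_mull_le => //; exact/ltW/exprn_gt0.
apply: le_trans.
  apply: (lebesgue_outer_le_esum D (fun I => (c *: I.1 + b, c *: I.2 + b))) => //.
  move=> _ [x /AD[I DI xI] <-]; exists I => // i /=.
  by rewrite !mxE ltrD2r lerD2r ltr_pM2l// ler_pM2l.
apply: le_esum => I _; rewrite lee_fin /box_volume.
rewrite -[in c ^+ n](card_ord n) -prodr_const -big_split/=.
rewrite le_eqVlt; apply/orP; left; apply/eqP/eq_bigr => i _.
by rewrite !mxE maxr_pMr ?ltW// mulr0; congr Num.max; ring.
Qed.

(** The hyperplane [x 0 i = c] cuts each half-open box of a cover into two half-open boxes, [lo] and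
    [hi], whose volumes add up; they cover the two parts of [X]. *)
Lemma caratheodory_halfspace (i : 'I_n) (c : R) :
  (@lebesgue_outer R n).-caratheodory [set x : E | x 0 i <= c].
Proof.
apply: le_caratheodory_measurable => X.
apply: le_ereal_inf_tmp => _ [D [cD XD] <-].
pose lo (I : E * E) : E * E :=
  (I.1, \row_j if j == i then Num.min (I.2 0 j) c else I.2 0 j).
pose hi (I : E * E) : E * E :=
  (\row_j if j == i then Num.max (I.1 0 j) c else I.1 0 j, I.2).
have vol0 (I : E * E) : (0 <= (box_volume I)%:E)%E by rewrite lee_fin box_volume_ge0.
rewrite (eq_esum (b := fun I => (box_volume (lo I))%:E + (box_volume (hi I))%:E)%E).
  rewrite esumD//; apply: leeD; apply: lebesgue_outer_le_esum => //.
  - move=> x [/XD[I DI xI] /= xc]; exists I => // j /=; rewrite mxE.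
    have := xI j; case: eqVneq => [->|//]; rewrite le_min xc => /andP[-> ->] //.
  - move=> x [/XD[I DI xI] /= /negP]; rewrite -ltNge => xc.
    exists I => // j /=; rewrite mxE.
    have := xI j; case: eqVneq => [->|//]; rewrite gt_max xc => /andP[-> ->] //.
move=> I _; rewrite -EFinD /box_volume !(bigD1 (P := xpredT) i)//= !mxE eqxx.
congr (_ %:E).
rewrite [in RHS](eq_bigr (fun j => Num.max 0 (I.2 0 j - I.1 0 j))); last first.
  by move=> j /negPf ji; rewrite mxE ji.
rewrite [X in _ = _ + _ * X](eq_bigr (fun j => Num.max 0 (I.2 0 j - I.1 0 j))); last first.
  by move=> j /negPf ji; rewrite mxE ji.
rewrite -mulrDl; congr (_ * _).
exact: max0_split.
Qed.

Lemma measurable_box (I : E * E) : measurable (box I : set (lebesgue_rV R n)).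
Proof.
rewrite (_ : box I = \bigcap_(i in [set: 'I_n])
  ([set x : E | x 0 i <= I.2 0 i] `&` ~` [set x : E | x 0 i <= I.1 0 i])).
  apply: fin_bigcap_measurable; first exact: finite_finset.
  move=> i _; apply: measurableI; first exact: caratheodory_halfspace.
  apply: measurableC; exact: caratheodory_halfspace.
apply/seteqP; split => x xI i.
  by move=> _; have /andP[h1 h2] := xI i; split => //=; apply/negP; rewrite -ltNge.
by have [/= -> /negP] := xI i Logic.I; rewrite -ltNge andbT.
Qed.

End lebesgue_rV_boxes.

(** * Total volume of a packing of cubes *)

Section cube_packings.
Context {R : realType} {n : nat}.
Local Notation E := 'rV[R]_n.

Lemma lebesgue_outer_box (I : E * E) :
  (lebesgue_outer (box I) <= (box_volume I)%:E)%E.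
Proof.
rewrite -(@esum_set1 _ _ I (fun I => (box_volume I)%:E)).
  by apply: (lebesgue_outer_le_esum [set I] id); [exact: countable1|rewrite bigcup_set1].
by rewrite lee_fin box_volume_ge0.
Qed.

Lemma cube_box (Q : set E) : cube Q -> exists I : E * E,
  [/\ box I `<=` Q°, (leb n Q <= (3 ^+ n)%:E * leb n (box I))%E
    & (leb n Q < +oo)%E].
Proof.
move=> [a [d [l [r [d0 Qdef]]]]].
pose I : E * E := (a + const_mx (d / 4), a + const_mx (3 * d / 4)).
have bound x i : x \in Interval (BSide (l i) (a 0 i)) (BSide (r i) (a 0 i + d)) ->
    a 0 i <= x <= a 0 i + d.
  by case: (l i); case: (r i); rewrite in_itv /=; lra.
have QI : (leb n Q <= (3 ^+ n)%:E * leb n (box I))%E.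
  (* This is the homothety of ratio 3 about the centre [a + d / 2] of the cube. The dilated edges
     run from [a - d / 4] to [a + 5 * d / 4], so they contain those of [Q] whichever endpoints [Q]
     includes. *)
  apply: le_trans (lebesgue_outer_homothety 3 (- (2 *: a + const_mx d)) (box I) _) => //.
  apply: le_lebesgue_outer => x; rewrite Qdef => /= Qx.
  exists (3^-1 *: (x + (2 *: a + const_mx d))).
    by move=> i; have /bound := Qx i; rewrite !mxE; lra.
  by rewrite scalerA mulfV// scale1r addrK.
exists I; split => //.
(* Neighbourhoods of a row vector are given entrywise; the open edges of [Q] serve here. *)
- move=> x Ix; exists (fun _ i => `]a 0 i, (a 0 i + d)[%classic).
    move=> k i; rewrite (ord1 k); apply: open_nbhs_nbhs; split.
      exact: interval_open.
    by have := Ix i; rewrite /= !mxE in_itv /=; lra.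
  move=> y yP; rewrite Qdef => i; have := yP 0 i.
  by case: (l i); case: (r i); rewrite /= !in_itv /=; lra.
- apply: le_lt_trans QI _; apply: le_lt_trans (_ : _ <= (3 ^+ n)%:E * (box_volume I)%:E)%E _.
    by rewrite lee_wpmul2l ?lee_fin ?exprn_ge0//; exact: lebesgue_outer_box.
  by rewrite -EFinM ltry.
Qed.

Lemma volE (Q : set E) : cube Q -> ((vol Q)%:E = leb n Q)%E.
Proof.
by move=> /cube_box[I [_ _ Qoo]]; rewrite /vol fineK// ge0_fin_numE.
Qed.

Lemma vol_ge0 (Q : set E) : 0 <= vol Q.
Proof. exact: fine_ge0. Qed.

Lemma esum_vol_le (Q0 : set E) (D : set (set E)) : cube Q0 ->
  cube_packings Q0 D ->
  (\esum_(Q in D) (vol Q)%:E <= (3 ^+ n * vol Q0)%:E)%E.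
Proof.
move=> cQ0 [DQ0 tD].
have /choice[I IP] : forall Q : set E, exists I : E * E, cube Q ->
    box I `<=` Q° /\ (leb n Q <= (3 ^+ n)%:E * leb n (box I))%E.
  move=> Q; have [cQ|nQ] := pselect (cube Q); last by exists (0, 0).
  by have [I [? ? _]] := cube_box _ cQ; exists I.
have c3 : 0 <= 3 ^+ n :> R by rewrite exprn_ge0.
apply: (@le_trans _ _ (\esum_(Q in D) ((3 ^+ n)%:E * leb n (box (I Q))))%E).
  apply: le_esum => Q /DQ0[cQ _]; rewrite volE//; exact: (IP Q cQ).2.
apply: le_trans (esum_mull_le _ _ _ c3 _) _ => //.
rewrite EFinM volE// lee_wpmul2l ?lee_fin//.
(* The sum is a supremum over finite subfamilies, to which finite additivity applies: the boxes are
   measurable, and disjoint because they lie in the disjoint interiors of the cubes. *)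
apply: ge_ereal_sup => _ [F [finF FD] <-].
rewrite -measure_fin_bigcup//.
- apply: le_lebesgue_outer => x [Q /FD/DQ0[cQ QQ0]] /(IP Q cQ).1 /interior_subset.
  exact: QQ0.
- move=> Q Q' FQ FQ' [x [xQ xQ']]; apply: tD; [exact: FD|exact: FD|].
  exists x; split.
    by apply: (IP Q _).1 xQ; have [] := DQ0 _ (FD _ FQ).
  by apply: (IP Q' _).1 xQ'; have [] := DQ0 _ (FD _ FQ').
- by move=> Q _; exact: measurable_box.
Qed.

End cube_packings.

(** * Two-sided bounds on the JN norm and its limit *)

Section JN_norm_limit.
Context {R : realType} {n : nat}.
Local Notation E := 'rV[R]_n.
Context (q alpha : R) (s : nat) (Q0 : set E) (hq : 1 <= q) (cQ0 : cube Q0).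
Implicit Types f : E -> R.

Lemma oscillation_ge0 f (Q : set E) : (0 <= oscillation q alpha s f Q)%E.
Proof. by rewrite mule_ge0// ?lee_fin ?powR_ge0// poweR_ge0. Qed.

(* As [0^-1 = 0], the average over a set of null volume is [0]: thanks to this
   junk value, the positivity of the volume of cubes is never needed (the [+ 1]
   in [JN_norm_le] makes the constant positive without it). *)
Lemma oscillation_null f (Q : set E) : vol Q = 0 ->
  oscillation q alpha s f Q = 0%E.
Proof.
move=> vQ; rewrite /oscillation /average vQ invr0 mul0e poweR0r ?mule0//.
by rewrite invr_eq0 gt_eqF// (lt_le_trans ltr01).
Qed.

Lemma JN_norm_ge0 p f : (0 <= JN_norm p q s alpha Q0 f)%E.
Proof. exact: poweR_ge0. Qed.

Lemma campanato_norm_ge0 f : (0 <= campanato_norm alpha q s Q0 f)%E.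
Proof.
apply: le_trans (oscillation_ge0 f Q0) _; apply: ereal_sup_ubound.
by exists Q0 => //; split.
Qed.

(** The real [z] stands in for the oscillation on [Q], which may be infinite. *)
Lemma JN_norm_ge p f (Q : set E) (z : R) : 0 < p -> subcubes Q0 Q -> 0 <= z ->
  (z%:E <= oscillation q alpha s f Q)%E ->
  ((vol Q `^ p^-1 * z)%:E <= JN_norm p q s alpha Q0 f)%E.
Proof.
move=> p0 QQ0 z0 zQ.
have -> : (vol Q `^ p^-1 * z)%:E = ((vol Q * z `^ p)%:E `^ p^-1)%E.
  by rewrite poweR_EFin powRM ?vol_ge0 ?powR_ge0// -powRrM mulfV ?gt_eqF// powRr1.
have le1 : ((vol Q * z `^ p)%:E <=
    (vol Q)%:E * oscillation q alpha s f Q `^ p)%E.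
  rewrite EFinM lee_wpmul2l ?lee_fin ?vol_ge0// -poweR_EFin.
  by apply: le_poweRl => //; exact: ltW.
have le2 : ((vol Q * z `^ p)%:E <= ereal_sup
    [set (\esum_(Q in D) ((vol Q)%:E * oscillation q alpha s f Q `^ p))%E
       | D in cube_packings Q0])%E.
  apply: le_trans le1 _; apply: ereal_sup_ubound; exists [set Q].
    by split; [move=> _ ->|exact: trivIset1].
  by rewrite esum_set1// mule_ge0 ?lee_fin ?vol_ge0 ?poweR_ge0.
have v0 : (0 <= (vol Q * z `^ p)%:E)%E by rewrite lee_fin mulr_ge0 ?vol_ge0 ?powR_ge0.
by apply: le_poweRl => //; rewrite invr_ge0 ltW.
Qed.

Lemma JN_norm_le p f (M : R) : 0 < p ->
  campanato_norm alpha q s Q0 f = M%:E ->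
  (JN_norm p q s alpha Q0 f <= ((3 ^+ n * vol Q0 + 1) `^ p^-1 * M)%:E)%E.
Proof.
move=> p0 fM.
have M0 : 0 <= M by have := campanato_norm_ge0 f; rewrite fM.
have C0 : 0 <= 3 ^+ n * vol Q0 by rewrite mulr_ge0 ?vol_ge0 ?exprn_ge0.
set C := _ + 1; have C1 : 0 <= C by rewrite addr_ge0.
have -> : (C `^ p^-1 * M)%:E = ((C * M `^ p)%:E `^ p^-1)%E.
  by rewrite poweR_EFin powRM ?powR_ge0// -powRrM mulfV ?gt_eqF// powRr1.
rewrite /JN_norm; set S := ereal_sup _.
(* The empty packing contributes the value 0; monotonicity of the power requires this sign. *)
have S0 : (0 <= S)%E.
  apply: ereal_sup_ubound; exists set0; last exact: esum_set0.
  by split; [exact: sub0set|move=> ? ? []].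
have SC : (S <= (C * M `^ p)%:E)%E.
  apply: ge_ereal_sup => _ [D DQ0 <-].
  apply: (@le_trans _ _ (\esum_(Q in D) ((M `^ p)%:E * (vol Q)%:E))%E).
    apply: le_esum => Q DQ; rewrite muleC lee_wpmul2r ?lee_fin ?vol_ge0//.
    rewrite -poweR_EFin; apply: le_poweRl;
      [exact: ltW|exact: oscillation_ge0|].
    by rewrite -fM; apply: ereal_sup_ubound; exists Q => //; exact: DQ0.1.
  apply: le_trans (esum_mull_le _ _ _ _ _) _; first exact: powR_ge0.
    by move=> Q; rewrite lee_fin vol_ge0.
  rewrite muleC EFinM lee_wpmul2r ?lee_fin ?powR_ge0//.
  apply: le_trans (esum_vol_le _ _ cQ0 DQ0) _.
  by rewrite lee_fin lerDl.
by apply: le_poweRl => //; rewrite invr_ge0 ltW.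
Qed.

(** The convergence holds in the extended reals for every [f], also towards [+oo]. Finiteness of the
    limit is therefore the same as finiteness of the Campanato norm. *)
Lemma JN_norm_cvg f :
  JN_norm p q s alpha Q0 f @[p --> +oo%R] --> campanato_norm alpha q s Q0 f.
Proof.
apply: cvge_pinfty_lt; first exact: campanato_norm_ge0.
- move=> y yf; have [y0|y0] := ltP y 0.
    by near=> p; apply: lt_le_trans (JN_norm_ge0 _ _); rewrite lte_fin.
  have [_ [Q QQ0 <-] yQ] := ereal_sup_gt yf.
  have [z yz zQ] : exists2 z : R, y < z & (z%:E <= oscillation q alpha s f Q)%E.
    case: (oscillation q alpha s f Q) yQ => [z| |//] yz; first by exists z.
    by exists (y + 1); rewrite ?leey// ltrDl.
  have vQ : 0 < vol Q.
    rewrite lt_neqAle vol_ge0 andbT eq_sym; apply/eqP => vQ.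
    by move: yQ; rewrite oscillation_null// lte_fin ltNge y0.
  have cz : vol Q `^ p^-1 * z @[p --> +oo%R] --> z.
    by rewrite -[X in _ --> X]mul1r; apply: cvgMr_tmp; exact: cvg_powR_inv.
  near=> p; have p0 : 0 < p by near: p; exact: nbhs_pinfty_gt.
  apply: lt_le_trans (JN_norm_ge _ _ _ _ p0 QQ0 (le_trans y0 (ltW yz)) zQ).
  by rewrite lte_fin; near: p; exact: (cvgr_gt _ cz).
- case fM : (campanato_norm alpha q s Q0 f) => [M| |] y; last 2 first.
  + by rewrite ltNge leey.
  + by have := campanato_norm_ge0 f; rewrite fM.
  rewrite lte_fin => My.
  have cM : (3 ^+ n * vol Q0 + 1) `^ p^-1 * M @[p --> +oo%R] --> M.
    rewrite -[X in _ --> X]mul1r; apply: cvgMr_tmp; apply: cvg_powR_inv.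
    by rewrite ltr_wpDl// mulr_ge0 ?vol_ge0 ?exprn_ge0.
  near=> p; have p0 : 0 < p by near: p; exact: nbhs_pinfty_gt.
  apply: le_lt_trans (JN_norm_le _ _ _ p0 fM) _.
  by rewrite lte_fin; near: p; exact: (cvgr_lt _ cM).
Unshelve. all: by end_near. Qed.

End JN_norm_limit.

Theorem corollary3p4 (R : realType) (n : nat) (hn : (0 < n)%N)
    (q alpha : R) (hq : 1 <= q) (s : nat) (Q0 : set 'rV[R]_n) (hQ0 : cube Q0) :
  campanato alpha q s Q0 =
    [set f | (\bigcap_(p in [set p : R | 1 <= p]) JN p q s alpha Q0) f /\
             cvg (JN_norm p q s alpha Q0 f @[p --> +oo%R]) /\
             (lim (JN_norm p q s alpha Q0 f @[p --> +oo%R]) < +oo)%E] /\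
  forall f : 'rV[R]_n -> R, campanato alpha q s Q0 f ->
    JN_norm p q s alpha Q0 f @[p --> +oo%R] --> campanato_norm alpha q s Q0 f.
Proof.
split=> [|f _]; last exact: JN_norm_cvg.
apply/seteqP; split => f /=.
  move=> [fq foo]; have cf := JN_norm_cvg q alpha s Q0 hq hQ0 f.
  split; last by split; [exact: cvgP cf|rewrite (cvg_lim _ cf)].
  move=> p p1; split => //.
  have fM : campanato_norm alpha q s Q0 f =
      (fine (campanato_norm alpha q s Q0 f))%:E.
    by rewrite fineK// ge0_fin_numE// campanato_norm_ge0.
  apply: le_lt_trans (JN_norm_le _ _ _ _ hQ0 _ _ _ _ fM) _; last exact: ltry.
  exact: lt_le_trans p1.
(* Membership in [Lq] is read off from the exponent [p = 1]. *)
move=> [fJN [_ limf]]; split; first by have [] := fJN 1 (lexx _).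
by move: limf; rewrite (cvg_lim _ (JN_norm_cvg q alpha s Q0 hq hQ0 f)).
Qed.
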